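(* Let $m\ge 2$ be an integer and let $G^{\mathrm{U}}(n,m)$, $n\ge m+1$, be the uniform attachment random graph on the vertex set $[n]=\{1,\ldots,n\}$. Then $G^{\mathrm{U}}(n,m)$ does not obey the first-order (FO) 0-1 law; that is, there exists an FO sentence $\varphi$ about graphs (which may depend on $m$) such that $\mathsf{P}\bigl(G^{\mathrm{U}}(n,m)\models\varphi\bigr)$ converges neither to $0$ nor to $1$ as $n\to\infty$.
   Context: Graphs are finite, simple and undirected. For $m\in\mathbb{N}$, the uniform attachment random graph is defined recursively: $G^{\mathrm{U}}(m+1,m)$ is the complete graph on $[m+1]$. For every $n\ge m+1$, $G^{\mathrm{U}}(n+1,m)$ is obtained from $G^{\mathrm{U}}(n,m)$ by adding the vertex $n+1$ together with $m$ edges from $n+1$ to $m$ distinct vertices of $[n]$, where the $m$-element set of neighbours is chosen uniformly at random among all $\binom{n}{m}$ $m$-subsets of $[n]$, independently of the previous steps. First-order (FO) sentences about graphs are built from variables $x,y,x_1,\ldots$ (ranging over vertices), logical connectives $\wedge,\vee,\neg,\Rightarrow,\Leftrightarrow$, the binary predicates $\sim$ (adjacency) and $=$ (equality), the quantifiers $\exists,\forall$, and brackets. Vertex labels are not available in the language. A sentence has no free variables. $G\models\varphi$ means that $\varphi$ is true on $G$. A random graph $\mathcal{G}_n$ obeys the FO 0-1 law if, for every FO sentence $\varphi$, $\mathsf{P}(\mathcal{G}_n\models\varphi)$ approaches either $0$ or $1$ as $n\to\infty$. *)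

(* Defs.v *)
From HB Require Import structures.
From mathcomp Require Import all_boot all_order all_algebra.
From mathcomp Require Import all_classical all_reals topology normedtype sequences.

Set Implicit Arguments.
Unset Strict Implicit.
Unset Printing Implicit Defensive.

Import Order.TTheory GRing.Theory Num.Theory.
Import numFieldNormedType.Exports.

Local Open Scope classical_set_scope.
Local Open Scope ring_scope.

(* Vertices are 0-based: the vertex set [n] = {1, ..., n} is 'I_n. *)
Definition simple_adj n (e : {ffun 'I_n * 'I_n -> bool}) : bool :=
  [forall x, ~~ e (x, x)] && [forall x, forall y, e (x, y) == e (y, x)].

Record sgraph n := SGraph {
  sgraph_val : {ffun 'I_n * 'I_n -> bool};
  _ : simple_adj sgraph_val }.

HB.instance Definition _ n := [isSub for @sgraph_val n].
HB.instance Definition _ n := [Finite of sgraph n by <:].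

Definition adj n (G : sgraph n) : rel 'I_n := fun x y => sgraph_val G (x, y).

Lemma adj_irr n (G : sgraph n) : irreflexive (adj G).
Proof. by move=> x; rewrite /adj; case: G => e /= /andP[/forallP/(_ x)/negbTE]. Qed.

Lemma adj_sym n (G : sgraph n) : symmetric (adj G).
Proof.
move=> x y; rewrite /adj; case: G => e /=.
by move=> /andP[_ /forallP/(_ x)/forallP/(_ y)/eqP].
Qed.

Lemma simple_adj_of_rel n (r : rel 'I_n) :
  irreflexive r -> symmetric r -> simple_adj [ffun p => r p.1 p.2].
Proof.
move=> ri rs; apply/andP; split; first by apply/forallP=> x; rewrite ffunE /= ri.
by apply/forallP=> x; apply/forallP=> y; rewrite !ffunE /= rs.
Qed.

Definition sgraph_of_rel n (r : rel 'I_n) (ri : irreflexive r)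
  (rs : symmetric r) : sgraph n := SGraph (simple_adj_of_rel ri rs).

Lemma adj_of_rel n (r : rel 'I_n) (ri : irreflexive r) (rs : symmetric r) :
  adj (sgraph_of_rel ri rs) =2 r.
Proof. by move=> x y; rewrite /adj /= ffunE. Qed.

Definition neq_rel n : rel 'I_n := fun x y => x != y.

Lemma neq_rel_irr n : irreflexive (@neq_rel n).
Proof. by move=> x; rewrite /neq_rel eqxx. Qed.

Lemma neq_rel_sym n : symmetric (@neq_rel n).
Proof. by move=> x y; rewrite /neq_rel eq_sym. Qed.

Definition complete_graph n : sgraph n :=
  sgraph_of_rel (@neq_rel_irr n) (@neq_rel_sym n).

(* The new vertex is [ord_max : 'I_n.+1]; [unlift ord_max] sends it to [None]
   and every other vertex to its copy in 'I_n. *)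
Definition attach_rel n (G : sgraph n) (A : {set 'I_n}) : rel 'I_n.+1 :=
  fun x y =>
    match unlift ord_max x, unlift ord_max y with
    | Some i, Some j => adj G i j
    | Some i, None => i \in A
    | None, Some j => j \in A
    | None, None => false
    end.

Lemma attach_rel_irr n (G : sgraph n) (A : {set 'I_n}) :
  irreflexive (attach_rel G A).
Proof. by move=> x; rewrite /attach_rel; case: unlift => // i; rewrite adj_irr. Qed.

Lemma attach_rel_sym n (G : sgraph n) (A : {set 'I_n}) :
  symmetric (attach_rel G A).
Proof.
move=> x y; rewrite /attach_rel.
by case: (unlift _ x); case: (unlift _ y) => // *; rewrite adj_sym.
Qed.

Definition attach n (G : sgraph n) (A : {set 'I_n}) : sgraph n.+1 :=
  sgraph_of_rel (@attach_rel_irr n G A) (@attach_rel_sym n G A).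

Section Laws.
Variable R : realType.

Definition prob_of n (mu : {ffun sgraph n -> R}) (E : pred (sgraph n)) : R :=
  \sum_(G | E G) mu G.

Definition dirac_law n (G0 : sgraph n) : {ffun sgraph n -> R} :=
  [ffun G => (G == G0)%:R].

(* Law of [attach G A] for G of law [mu] and, independently of G, A uniform
   among the m-subsets of 'I_n. *)
Definition attach_law m n (mu : {ffun sgraph n -> R}) : {ffun sgraph n.+1 -> R} :=
  [ffun H => \sum_G \sum_(A : {set 'I_n} | #|A| == m)
    mu G * ('C(n, m)%:R)^-1 * (attach G A == H)%:R].

(* The law of the uniform attachment graph on n vertices, as a probability mass
   function. It starts from the complete graph on m + 1 vertices; for n < m + 1,
   where the random graph is not defined, the value is a dummy. *)
Fixpoint ua_law m n : {ffun sgraph n -> R} :=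
  match n with
  | 0 => dirac_law (complete_graph 0)
  | n'.+1 => if (m.+1 <= n')%N then attach_law m (ua_law m n')
             else dirac_law (complete_graph n'.+1)
  end.

Lemma ua_law_ge0 m n (G : sgraph n) : 0 <= ua_law m n G.
Proof.
elim: n G => [|n IHn] G /=; first by rewrite ffunE ler0n.
case: ifP => _; rewrite ffunE ?ler0n //.
apply: sumr_ge0 => H _; apply: sumr_ge0 => A _.
by rewrite !mulr_ge0 ?invr_ge0 ?ler0n.
Qed.

Lemma ua_law_sum1 m n : \sum_G ua_law m n G = 1.
Proof.
have dirac1 k (G0 : sgraph k) : \sum_G dirac_law G0 G = 1.
  rewrite (bigD1 G0) //= ffunE eqxx big1 ?addr0 // => G /negbTE neG.
  by rewrite ffunE neG.
elim: n => [|n IHn] /=; first exact: dirac1.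
case: ifP => [lt_mn|_]; last exact: dirac1.
under eq_bigr => H _ do rewrite ffunE.
rewrite exchange_big /= -[RHS]IHn; apply: eq_bigr => G _.
rewrite exchange_big /=.
transitivity (\sum_(A : {set 'I_n} | #|A| == m)
    ua_law m n G * ('C(n, m)%:R)^-1).
  apply: eq_bigr => A _; rewrite -mulr_sumr.
  rewrite (bigD1 (attach G A)) //= eqxx big1 ?addr0 ?mulr1 // => H.
  by rewrite eq_sym => /negbTE ->.
rewrite sumr_const -[LHS]mulr_natr -mulrA.
have -> : #|[pred A : {set 'I_n} | #|A| == m]| = 'C(n, m).
  by rewrite -[n in RHS]card_ord -card_draws cardsE.
by rewrite mulVf ?mulr1 // pnatr_eq0 -lt0n bin_gt0 ltnW.
Qed.

End Laws.

(* First-order formulas whose free variables are among the k variables 'I_k.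
   Quantifiers bind the variable [ord0] of their body; the other variables of
   the body are shifted by one. *)
Inductive fo : nat -> Type :=
| fo_adj k : 'I_k -> 'I_k -> fo k
| fo_eq k : 'I_k -> 'I_k -> fo k
| fo_not k : fo k -> fo k
| fo_and k : fo k -> fo k -> fo k
| fo_or k : fo k -> fo k -> fo k
| fo_imp k : fo k -> fo k -> fo k
| fo_iff k : fo k -> fo k -> fo k
| fo_ex k : fo k.+1 -> fo k
| fo_all k : fo k.+1 -> fo k.

Definition fo_sentence : Type := fo 0.

Definition env_cons (T : Type) k (x : T) (env : 'I_k -> T) : 'I_k.+1 -> T :=
  fun i => oapp env x (unlift ord0 i).

Fixpoint fo_sat n (G : sgraph n) k (phi : fo k) : ('I_k -> 'I_n) -> bool :=
  match phi in fo k return ('I_k -> 'I_n) -> bool with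
  | fo_adj _ i j => fun env => adj G (env i) (env j)
  | fo_eq _ i j => fun env => env i == env j
  | fo_not _ p => fun env => ~~ fo_sat G p env
  | fo_and _ p q => fun env => fo_sat G p env && fo_sat G q env
  | fo_or _ p q => fun env => fo_sat G p env || fo_sat G q env
  | fo_imp _ p q => fun env => fo_sat G p env ==> fo_sat G q env
  | fo_iff _ p q => fun env => fo_sat G p env == fo_sat G q env
  | fo_ex _ p => fun env => [exists x : 'I_n, fo_sat G p (env_cons x env)]
  | fo_all _ p => fun env => [forall x : 'I_n, fo_sat G p (env_cons x env)]
  end.

Definition empty_env (T : Type) : 'I_0 -> T :=
  fun i => False_rect T (notF (ltn_ord i)).

Definition models n (G : sgraph n) (phi : fo_sentence) : bool :=
  fo_sat G phi (@empty_env 'I_n).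

(* P(G_n |= phi), for a random graph G_n of law [mu n]. *)
Definition prob_models (R : realType) (mu : forall n, {ffun sgraph n -> R})
    (phi : fo_sentence) (n : nat) : R :=
  prob_of (mu n) (fun G => models G phi).

Definition obeys_FO_01_law (R : realType)
    (mu : forall n, {ffun sgraph n -> R}) : Prop :=
  forall phi : fo_sentence,
    (prob_models mu phi n @[n --> \oo] --> (0 : R)) \/
    (prob_models mu phi n @[n --> \oo] --> (1 : R)).

(* Main.v *)
(** For M large, the existential sentence "the m-th power of the path on M
    vertices is a subgraph" witnesses the failure of the 0-1 law. Its probability
    is nondecreasing in n, and it is positive because attaching every new vertex
    to the m latest ones produces exactly the m-th power of a path.

    For the upper bound, any m + 2 consecutive vertices of the path span K_{m+2}
    minus at most one edge. When the last of these m + 2 vertices was added, its m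
    neighbours were an m-subset of an (m+1)-clique. There are O(n) m-cliques on
    average, so an (m+1)-clique appears at step n with probability
    O(n / binom(n, m)) = O(1/n); hence there are on average O(log n) = o(n) of
    them, and the probability that a K_{m+2} minus an edge is completed at step n
    is O(log n / n^2), which is summable. So with positive probability no such
    subgraph has a vertex of label at least t, for t large, whereas a copy of the
    path power on M > t vertices must use such a label. *)
Require Import Defs.
From mathcomp Require Import all_boot all_order all_algebra.
From mathcomp Require Import zify ring lra.

Import Order.TTheory GRing.Theory Num.Theory.


Set Implicit Arguments.
Unset Strict Implicit.

(** * Attaching a vertex: effect on cliques *)

Lemma attach_lift_lift n (G : sgraph n) A i j :
  adj (attach G A) (lift ord_max i) (lift ord_max j) = adj G i j.
Proof. by rewrite /attach adj_of_rel /attach_rel !liftK. Qed.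

Lemma attach_max_lift n (G : sgraph n) A j :
  adj (attach G A) ord_max (lift ord_max j) = (j \in A).
Proof. by rewrite /attach adj_of_rel /attach_rel liftK unlift_none. Qed.

Lemma attach_lift_max n (G : sgraph n) A j :
  adj (attach G A) (lift ord_max j) ord_max = (j \in A).
Proof. by rewrite adj_sym attach_max_lift. Qed.

Definition attachE := (attach_lift_lift, attach_max_lift, attach_lift_max).

Definition clique n (G : sgraph n) (B : {set 'I_n}) : bool :=
  [forall x in B, forall y in B, (x != y) ==> adj G x y].

Lemma cliqueP n (G : sgraph n) (B : {set 'I_n}) :
  reflect {in B &, forall x y, x != y -> adj G x y} (clique G B).
Proof.
apply: (iffP 'forall_in_'forall_in_implyP) => H x.
  by move=> y xB yB; apply: H.
by move=> xB y yB; apply: H.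
Qed.

Definition cliques n (G : sgraph n) j : {set {set 'I_n}} :=
  [set B : {set _} | (#|B| == j) && clique G B].

Definition old_part n (C : {set 'I_n.+1}) : {set 'I_n} := lift ord_max @^-1: C.

Lemma lift_old n (C : {set 'I_n.+1}) : lift ord_max @: old_part C = C :\ ord_max.
Proof.
apply/setP=> x; rewrite !inE; case: (unliftP ord_max x) => [y ->|->].
  by rewrite mem_imset ?inE 1?eq_sym ?neq_lift //; apply: lift_inj.
rewrite eqxx /=; apply/negbTE/imsetP=> -[y _ /eqP].
by rewrite (negbTE (neq_lift _ _)).
Qed.

Lemma card_old n (C : {set 'I_n.+1}) : #|C| = ((ord_max \in C) + #|old_part C|)%N.
Proof.
by rewrite (cardsD1 ord_max C) -lift_old card_imset //; apply: lift_inj.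
Qed.

Lemma clique_old n (G : sgraph n) A C : clique (attach G A) C -> clique G (old_part C).
Proof.
move=> /cliqueP cC; apply/cliqueP=> x y; rewrite !inE => xC yC xy.
by rewrite -(attach_lift_lift G A) cC // (inj_eq lift_inj).
Qed.

Lemma clique_old_sub n (G : sgraph n) (A : {set 'I_n}) C :
  clique (attach G A) C -> ord_max \in C -> old_part C \subset A.
Proof.
move=> /cliqueP cC mC; apply/subsetP=> x; rewrite inE => xC.
by rewrite -(attach_max_lift G) cC // neq_lift.
Qed.

(** A clique of the new graph that avoids the new vertex is a copy of an old one. A clique through
    the new vertex is determined by its old part, a [j]-clique inside the neighbourhood [A]. *)
Lemma card_cliques_attach n (G : sgraph n) (A : {set 'I_n}) j :
  (#|cliques (attach G A) j.+1| <=
   #|cliques G j.+1| + #|[set B in cliques G j | B \subset A]|)%N.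
Proof.
set X := cliques G j.+1; set Y := [set _ in _ | _].
pose up (B : {set 'I_n}) : {set 'I_n.+1} := lift ord_max @: B.
suff sub : cliques (attach G A) j.+1 \subset
    (up @: X) :|: ((fun B => ord_max |: up B) @: Y).
  apply: leq_trans (subset_leq_card sub) _.
  apply: leq_trans (leq_card_setU _ _) _.
  by apply: leq_add; apply: leq_imset_card.
apply/subsetP=> C; rewrite inE => /andP[/eqP szC cC].
move: szC; rewrite card_old; case: (boolP (ord_max \in C)) => mC szC.
  apply/setUP; right; apply/imsetP; exists (old_part C).
    rewrite !inE (clique_old cC) (clique_old_sub cC) // !andbT.
    by move: szC; rewrite add1n => -[->].
  by rewrite /up lift_old setD1K.
apply/setUP; left; apply/imsetP; exists (old_part C).
  by rewrite inE (clique_old cC) -szC add0n eqxx.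
by rewrite /up lift_old; apply/setP=> x; rewrite !inE; case: eqP => // ->; apply/negbTE.
Qed.

Lemma card_cliques_within n (G : sgraph n) (A : {set 'I_n}) j :
  (#|[set B in cliques G j | B \subset A]| <= 'C(#|A|, j))%N.
Proof.
rewrite -cards_draws; apply: subset_leq_card; apply/subsetP=> B; rewrite !inE.
by move=> /andP[/andP[-> _] ->].
Qed.

(** By cardinality, the only candidate is [A] itself. *)
Lemma card_cliques_within_same n (G : sgraph n) (A : {set 'I_n}) m : #|A| = m ->
  (#|[set B in cliques G m | B \subset A]| <= (A \in cliques G m))%N.
Proof.
move=> szA.
have sub1 B : B \in [set B in cliques G m | B \subset A] -> B = A.
  rewrite !inE => /andP[/andP[/eqP szB _] BA].
  by apply/eqP; rewrite eqEcard BA szA szB leqnn.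
case: (boolP (A \in _)) => AC.
  apply: leq_trans (_ : #|[set A]| <= _)%N; last by rewrite cards1.
  apply: subset_leq_card; apply/subsetP=> B /sub1 ->.
  by rewrite inE.
rewrite leqn0 cards_eq0; apply/eqP/setP=> B; rewrite in_set0; apply/negbTE/negP=> BS.
by have BA := sub1 _ BS; move: BS AC; rewrite BA inE => /andP[->].
Qed.

(** * Near-cliques and the choices of neighbours that create them *)

(** These are the dangerous draws: only they can create a near-clique at the next step. *)
Definition extendable n (G : sgraph n) m (A : {set 'I_n}) : bool :=
  [exists B in cliques G m.+1, A \subset B].

(** Union bound over the (m+1)-cliques, each of which has m + 1 subsets of size m. *)
Lemma card_extendable n (G : sgraph n) m :
  (\sum_(A : {set 'I_n} | #|A| == m) extendable G m A <= m.+1 * #|cliques G m.+1|)%N.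
Proof.
apply: (@leq_trans (\sum_(A : {set 'I_n} | #|A| == m)
    \sum_(B in cliques G m.+1) (A \subset B))%N).
  apply: leq_sum => A _; case: (boolP (extendable _ _ _)) => // /existsP[B /andP[BC AB]].
  by rewrite (bigD1 B) //= AB.
rewrite exchange_big /= mulnC -sum_nat_const; apply: leq_sum => B.
rewrite inE => /andP[/eqP szB _].
rewrite -big_mkcondr /= sum1dep_card.
rewrite (_ : [set _ | _] = [set A : {set 'I_n} | A \subset B & #|A| == m]); last first.
  by apply/setP=> A; rewrite !inE andbC.
by rewrite cards_draws szB binSn.
Qed.

(* [K] together with [u] and [w] spans a complete graph on m + 2 vertices, with
   the possible exception of the edge [u w]. *)
Definition near_clique_from n (G : sgraph n) m t : bool :=
  [exists K : {set 'I_n}, exists u : 'I_n, exists w : 'I_n,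
    [&& #|K| == m, clique G K, u != w, K \subset [set x | adj G u x],
        K \subset [set x | adj G w x] & [exists v : 'I_n, (t <= v)%N && (v \in u |: (w |: K))]]].

Lemma near_clique_fromP n (G : sgraph n) m t :
  reflect (exists (K : {set 'I_n}) (u w v : 'I_n), [/\ #|K| = m, clique G K, u != w,
     {in K, forall x, adj G u x && adj G w x} & (t <= v)%N /\ v \in u |: (w |: K)])
    (near_clique_from G m t).
Proof.
apply: (iffP existsP) => [[K]|[K [u [w [v [/eqP h1 h2 h3 h4 [h5 h6]]]]]]].
  move=> /existsP[u /existsP[w /and5P[/eqP h1 h2 h3 /subsetP h4]]].
  move=> /andP[/subsetP h5 /existsP[v /andP[h6 h7]]].
  exists K, u, w, v; split => // x xK.
  by move: (h4 _ xK) (h5 _ xK); rewrite !inE => -> ->.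
exists K; apply/existsP; exists u; apply/existsP; exists w.
rewrite h1 h2 h3 /=; apply/and3P; split; last by apply/existsP; exists v; rewrite h5.
  by apply/subsetP=> x /h4/andP[]; rewrite inE.
by apply/subsetP=> x /h4/andP[]; rewrite inE.
Qed.

(** When the new vertex is one of the two apexes, the core [K] lies in its neighbourhood [A] and has
    the same size, so it equals [A]. The other apex then completes [A] to an (m+1)-clique of the old
    graph. *)
Lemma near_clique_apex_extendable n (G : sgraph n) m (A : {set 'I_n})
    (K : {set 'I_n.+1}) w :
  #|A| = m -> #|K| = m -> clique (attach G A) K -> ord_max != w ->
  {in K, forall x, adj (attach G A) ord_max x && adj (attach G A) w x} ->
  extendable G m A.
Proof.
move=> szA szK cK; case: (unliftP ord_max w) => [w' ->|-> /eqP //] _ adjK.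
have mK : ord_max \notin K.
  by apply/negP=> /adjK/andP[]; rewrite adj_irr.
have szo : #|old_part K| = m by rewrite -szK (card_old K) (negbTE mK).
have oA : old_part K = A.
  apply/eqP; rewrite eqEcard szo szA leqnn andbT; apply/subsetP=> x.
  by rewrite inE => /adjK/andP[]; rewrite attachE.
have wadj x : x \in A -> adj G w' x.
  by rewrite -oA inE => /adjK/andP[_]; rewrite attachE.
have wA : w' \notin A by apply/negP=> /wadj; rewrite adj_irr.
apply/existsP; exists (w' |: A); rewrite !inE subsetUr andbT cardsU1 wA szA eqxx /=.
have /cliqueP cA : clique G A by rewrite -oA; apply: clique_old cK.
apply/cliqueP=> x y; rewrite !inE => /orP[/eqP->|xA] /orP[/eqP->|yA].
- by rewrite eqxx.
- by move=> _; apply: wadj.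
- by move=> _; rewrite adj_sym; apply: wadj.
- exact: cA.
Qed.

(** The cases follow the role of the new vertex: as an apex it makes [A] extendable, it cannot lie
    in the core, and otherwise the near-clique is already in [G]. *)
Lemma near_clique_attach n (G : sgraph n) m t (A : {set 'I_n}) : #|A| = m ->
  near_clique_from (attach G A) m t -> near_clique_from G m t || extendable G m A.
Proof.
move=> szA /near_clique_fromP[K [u [w [v [szK cK uw adjK [tv vK]]]]]].
case: (unliftP ord_max u) uw adjK vK => [u' ->|->] uw adjK vK; last first.
  by rewrite (near_clique_apex_extendable szA szK cK uw adjK) orbT.
case: (unliftP ord_max w) uw adjK vK => [w' ->|->] uw adjK vK; last first.
  rewrite eq_sym in uw.
  rewrite (near_clique_apex_extendable szA szK cK uw) ?orbT // => x /adjK.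
  by rewrite andbC.
rewrite (inj_eq lift_inj) in uw.
have adjO x : x \in old_part K -> adj G u' x && adj G w' x.
  by rewrite inE => /adjK; rewrite !attachE.
case: (boolP (ord_max \in K)) => mK; last first.
  apply/orP; left; apply/near_clique_fromP.
  case: (unliftP ord_max v) tv vK => [v' ->|->] tv vK.
    exists (old_part K), u', w', v'; split=> //.
    - by rewrite -szK (card_old K) (negbTE mK).
    - exact: clique_old cK.
    - move: tv vK; rewrite lift_max !inE !(inj_eq lift_inj) => tv vK; by split.
  by move: vK; rewrite !inE (negbTE mK) !(negbTE (neq_lift _ _)).
(* The new vertex would have m + 1 neighbours. *)
exfalso.
have: (u' |: (w' |: old_part K)) \subset A.
  have /andP[] := adjK _ mK; rewrite !attachE => uA wA.
  by rewrite !subUset !sub1set uA wA (clique_old_sub cK mK).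
move=> /subset_leq_card; rewrite !cardsU1 szA !inE negb_or uw.
have -> : lift ord_max w' \notin K by apply/negP=> /adjK; rewrite adj_irr andbF.
have -> : lift ord_max u' \notin K by apply/negP=> /adjK; rewrite adj_irr.
by move: szK; rewrite card_old mK /= => <-; rewrite ltnn.
Qed.

(** * Copies of path powers contain near-cliques *)

(** A copy of the m-th power of a path as a subgraph, not necessarily induced. Injectivity is asked
    pairwise, in the form in which the first-order sentence expresses it. *)
Definition path_power_hom n (G : sgraph n) m M (g : 'I_M -> 'I_n) : Prop :=
  forall i j : 'I_M, (i < j)%N ->
    g i != g j /\ ((j <= i + m)%N -> adj G (g i) (g j)).

Definition has_path_power n (G : sgraph n) m M : Prop :=
  exists g : 'I_M -> 'I_n, path_power_hom G m g.

Lemma path_power_hom_inj n (G : sgraph n) m M (g : 'I_M -> 'I_n) :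
  path_power_hom G m g -> injective g.
Proof.
move=> hg i j eg; apply/val_inj/eqP; case: ltngtP => // /hg[].
  by rewrite eg eqxx.
by rewrite eg eqxx.
Qed.

Lemma path_power_hom_adj n (G : sgraph n) m M (g : 'I_M -> 'I_n) (i j : 'I_M) :
  path_power_hom G m g -> i != j -> (j <= i + m)%N -> (i <= j + m)%N ->
  adj G (g i) (g j).
Proof.
move=> hg; rewrite -val_eqE /=; case: (ltngtP i j) => // ij _ h1 h2.
  by case: (hg _ _ ij) => _; apply.
case: (hg _ _ ij) => _ h; by rewrite adj_sym; apply: h.
Qed.

Lemma has_path_power_attach n (G : sgraph n) m M A :
  has_path_power G m M -> has_path_power (attach G A) m M.
Proof.
move=> [g hg]; exists (lift ord_max \o g) => i j /hg[h1 h2] /=.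
by rewrite attachE (inj_eq lift_inj).
Qed.

(** Pigeonhole: otherwise [g] would inject [M] elements into [t]. *)
Lemma inj_large_value M n (g : 'I_M -> 'I_n) t : injective g -> (t < M)%N ->
  exists i, (t <= g i)%N.
Proof.
move=> gI tM; case: (boolP [exists i, (t <= g i)%N]) => [/existsP //|].
rewrite negb_exists => /forallP small.
have sm i : (g i < t)%N by rewrite ltnNge.
have fI : injective (fun i => Ordinal (sm i)).
  by move=> i j [/val_inj/gI].
by have := leq_card _ fI; rewrite !card_ord leqNgt tM.
Qed.

Lemma path_power_near_clique n (G : sgraph n) m M t : (m.+1 < M)%N -> (t < M)%N ->
  has_path_power G m M -> near_clique_from G m t.
Proof.
move=> mM tM [g hg]; have gI := path_power_hom_inj hg.
have [i ti] := inj_large_value gI tM.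
(* The window of m + 2 consecutive positions starts at [i], or earlier if it would overrun the end
   of the path; in both cases it contains [i]. *)
pose j := minn i (M - m.+2).
have ltj k : (k < m.+2)%N -> (j + k < M)%N.
  by rewrite /j; move: (ltn_ord i); lia.
pose p (k : 'I_m.+2) : 'I_M := Ordinal (ltj k (ltn_ord k)).
have pI : injective (g \o p).
  by apply: inj_comp => // a b [/addnI/val_inj].
(* [q] enumerates the inner positions 1, ..., m of the window, which form the core; positions 0 and
   m + 1 are the apexes. *)
pose q (k : 'I_m) : 'I_m.+2 := lift ord0 (widen_ord (leqnSn m) k).
have qE k : q k = k.+1 :> nat by rewrite /q lift0.
have qI : injective q.
  by move=> a b ab; apply/val_inj/succn_inj; rewrite -!qE ab.
(* Only the two ends of the window are more than m apart. *)
have bnd (a b : 'I_m.+2) : a != b -> (b <= a + m)%N -> (a <= b + m)%N ->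
    adj G (g (p a)) (g (p b)).
  move=> ab h1 h2; apply: (path_power_hom_adj hg) => /=; [|lia|lia].
  by apply: contra ab => /eqP /(congr1 (g)) /pI ->.
apply/near_clique_fromP.
exists [set g (p (q k)) | k : 'I_m], (g (p ord0)), (g (p ord_max)), (g i); split.
- by rewrite card_imset ?card_ord //; apply: inj_comp pI qI.
- apply/cliqueP=> _ _ /imsetP[a _ ->] /imsetP[b _ ->] ab.
  apply: bnd; first by apply: contra ab => /eqP ->.
  + by rewrite !qE; move: (ltn_ord a) (ltn_ord b); lia.
  + by rewrite !qE; move: (ltn_ord a) (ltn_ord b); lia.
- by rewrite (inj_eq pI).
- move=> _ /imsetP[a _ ->]; have am := ltn_ord a.
  have q0 : ord0 != q a by exact: neq_lift.
  have qm : ord_max != q a by rewrite -(inj_eq val_inj) [val (q a)]qE /=; lia.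
  by apply/andP; split; apply: bnd; rewrite // qE /=; lia.
- split => //.
  have ilt : (i - j < m.+2)%N by rewrite /j; move: (ltn_ord i); lia.
  have -> : i = p (Ordinal ilt).
    by apply: val_inj; rewrite /= subnKC // /j geq_minl.
  set k := Ordinal ilt; rewrite !inE !(inj_eq pI).
  case: (eqVneq k ord0) => //= k0; case: (eqVneq k ord_max) => //= k1.
  have k2 : (k.-1 < m)%N.
    by move: k0 k1 (ltn_ord k); rewrite -!val_eqE /=; lia.
  apply/imsetP; exists (Ordinal k2) => //; congr (g (p _)).
  apply: val_inj; rewrite [val (q _)]qE /=.
  by move: k0; rewrite -val_eqE /=; lia.
Qed.

From mathcomp Require Import all_classical all_reals topology normedtype sequences.

Import numFieldNormedType.Exports.

Local Open Scope ring_scope.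

(** * The first-order sentence *)

Fixpoint fo_exs k : fo k -> fo_sentence :=
  match k with
  | 0 => id
  | k'.+1 => fun phi => fo_exs (fo_ex phi)
  end.

Lemma env_cons_eta (T : Type) k (env : 'I_k.+1 -> T) :
  env_cons (env ord0) (env \o lift ord0) = env.
Proof.
by apply: funext => i; rewrite /env_cons; case: unliftP => [j ->|->].
Qed.

Lemma models_exsP n (G : sgraph n) k (phi : fo k) :
  models G (fo_exs phi) <-> exists env, fo_sat G phi env.
Proof.
elim: k phi => [|k IHk] phi /=.
  split=> [Gphi|[env]]; first by exists (@empty_env 'I_n).
  by rewrite /models (_ : env = @empty_env _) //; apply: funext => -[].
rewrite IHk; split=> [[env /= /existsP[x Gphi]]|[env Gphi]].
  by exists (env_cons x env).
by exists (env \o lift ord0); apply/existsP; exists (env ord0); rewrite env_cons_eta.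
Qed.

(** The language has no constant for truth: [x = x] serves as the empty conjunction, hence the need
    for at least one variable. *)
Definition fo_conj k (l : seq (fo k.+1)) : fo k.+1 :=
  foldr (@fo_and k.+1) (fo_eq ord0 ord0) l.

Lemma fo_sat_conj n (G : sgraph n) k (l : seq (fo k.+1)) env :
  fo_sat G (fo_conj l) env = all (fun p => fo_sat G p env) l.
Proof. by elim: l => [|p l IHl] /=; rewrite ?eqxx ?IHl. Qed.

(** Where a pair imposes nothing further, a harmless formula fills the place: [neq] once more for
    distant positions, a tautology for pairs that are not increasing. *)
Definition path_power_pair m M (p : 'I_M * 'I_M) : fo M :=
  let neq := fo_not (fo_eq p.1 p.2) in
  if (p.1 < p.2)%N then fo_and neq (if (p.2 <= p.1 + m)%N then fo_adj p.1 p.2 else neq)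
  else fo_eq p.1 p.1.

Definition path_power_sentence m M : fo_sentence :=
  fo_exs (fo_conj [seq path_power_pair m p | p <- enum {: 'I_M.+1 * 'I_M.+1}]).

Lemma models_path_power n (G : sgraph n) m M :
  models G (path_power_sentence m M) <-> has_path_power G m M.+1.
Proof.
rewrite models_exsP; split=> -[g hg]; exists g.
  move: hg; rewrite fo_sat_conj all_map => /allP hg i j ij.
  have /hg : (i, j) \in enum {: 'I_M.+1 * 'I_M.+1} by rewrite mem_enum.
  rewrite /= /path_power_pair /= ij /= => /andP[-> h]; split=> // jim.
  by move: h; rewrite jim.
rewrite fo_sat_conj all_map; apply/allP=> -[i j] _ /=.
rewrite /path_power_pair /=; case: ifP => [ij|_] /=; last by rewrite eqxx.
by have [nij h] := hg i j ij; rewrite nij /=; case: ifP => [/h|_] /=.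
Qed.

(** * The path power as an outcome of the attachment process *)

Definition path_power_rel m n : rel 'I_n :=
  fun x y => [&& x != y, (x <= y + m)%N & (y <= x + m)%N].

Lemma path_power_irr m n : irreflexive (@path_power_rel m n).
Proof. by move=> x; rewrite /path_power_rel eqxx. Qed.

Lemma path_power_sym m n : symmetric (@path_power_rel m n).
Proof. by move=> x y; rewrite /path_power_rel eq_sym; congr andb; rewrite andbC. Qed.

Definition path_power m n : sgraph n :=
  sgraph_of_rel (@path_power_irr m n) (@path_power_sym m n).

Lemma path_power_has_path_power m n : has_path_power (path_power m n) m n.
Proof.
exists id => i j ij; have nij : i != j by rewrite -val_eqE /= neq_ltn ij.
split=> // jim; rewrite adj_of_rel /path_power_rel nij jim andbT /=; lia.
Qed.

Lemma sgraph_eq n (G H : sgraph n) : adj G =2 adj H -> G = H.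
Proof. by move=> GH; apply/val_inj/ffunP=> -[x y]; apply: GH. Qed.

Lemma path_power_complete m n : (n <= m.+1)%N -> path_power m n = complete_graph n.
Proof.
move=> nm; apply: sgraph_eq => x y; rewrite !adj_of_rel /path_power_rel /neq_rel.
have := ltn_ord x; have := ltn_ord y => xn yn.
suff -> : [&& (x <= y + m)%N & (y <= x + m)%N] by rewrite andbT.
by apply/andP; split; lia.
Qed.

Lemma path_power_attach m n : (m <= n)%N ->
  exists2 A : {set 'I_n}, #|A| = m & attach (path_power m n) A = path_power m n.+1.
Proof.
(* The m latest vertices, n - m, ..., n - 1. *)
move=> mn; exists [set x : 'I_n | (n <= x + m)%N].
  have lt (k : 'I_m) : (n - m + k < n)%N by move: (ltn_ord k); lia.
  rewrite -[RHS](card_ord m) -(card_imset _ (f := fun k => Ordinal (lt k))); last first.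
    by move=> a b /(congr1 val)/addnI/val_inj.
  apply: eq_card => x; rewrite inE; apply/idP/imsetP => [nx|[k _ ->] /=]; last lia.
  have xlt : (x - (n - m) < m)%N by move: (ltn_ord x); lia.
  by exists (Ordinal xlt) => //; apply: val_inj => /=; lia.
apply: sgraph_eq => x y.
case: (unliftP ord_max x) => [x' ->|->]; case: (unliftP ord_max y) => [y' ->|->];
  rewrite ?attachE ?adj_irr // !adj_of_rel /path_power_rel ?inE ?(inj_eq lift_inj)
    ?lift_max //.
- have := ltn_ord x'; rewrite eq_sym neq_lift /=; lia.
- have := ltn_ord y'; rewrite neq_lift /=; lia.
Qed.

(** * Expected counts and their one-step recurrences *)

(** Absorbing twice gives n(n-1) C(n-2,m-2) = m(m-1) C(n,m), and C(n-2,m-2) is at least 1. Here m >=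
    2 yields the quadratic growth that makes the final series summable. *)
Lemma binomial_ge_square m n : (2 <= m)%N -> (m < n)%N ->
  (n * n.-1 <= m ^ 2 * 'C(n, m))%N.
Proof.
case: m => [|[|m]] //; case: n => [|[|n]] // _ mn.
have h1 := mul_bin_diag n.+2 m.+1; have h2 := mul_bin_diag n.+1 m.
have h3 : (0 < 'C(n, m))%N by rewrite bin_gt0; lia.
move: h1 h2 h3 => /=; nia.
Qed.

Section Mean.
Variables (R : realType) (m : nat).

(** Expectation of a natural-valued statistic, so that the combinatorial bounds apply as they are;
    events enter as booleans coerced to 0 or 1. *)
Definition mean n (f : sgraph n -> nat) : R := \sum_G ua_law R m n G * (f G)%:R.

Lemma prob_of_mean n (E : pred (sgraph n)) : prob_of (ua_law R m n) E = mean (fun G => E G).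
Proof.
rewrite /prob_of /mean big_mkcond; apply: eq_bigr => G _.
by case: (E G); rewrite ?mulr1 ?mulr0.
Qed.

Lemma mean_ge0 n (f : sgraph n -> nat) : 0 <= mean f.
Proof. by apply: sumr_ge0 => G _; rewrite mulr_ge0 ?ua_law_ge0. Qed.

Lemma mean_le n (f g : sgraph n -> nat) : (forall G, (f G <= g G)%N) -> mean f <= mean g.
Proof.
by move=> fg; apply: ler_sum => G _; rewrite ler_wpM2l ?ua_law_ge0 ?ler_nat.
Qed.

Lemma mean_cst n k : mean (fun _ : sgraph n => k) = k%:R.
Proof. by rewrite /mean -mulr_suml ua_law_sum1 mul1r. Qed.

Lemma mean0 n (f : sgraph n -> nat) : (forall G, f G = 0%N) -> mean f = 0.
Proof. by move=> f0; apply: big1 => G _; rewrite f0 mulr0. Qed.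

(** Conditioning on the graph before the last step. *)
Lemma mean_succ n (f : sgraph n.+1 -> nat) : (m < n)%N ->
  mean f = 'C(n, m)%:R^-1 * mean (fun G => \sum_(A : {set 'I_n} | #|A| == m) f (attach G A))%N.
Proof.
move=> mn; rewrite /mean /= mn.
under eq_bigr => H _ do rewrite ffunE mulr_suml.
rewrite exchange_big mulr_sumr /=; apply: eq_bigr => G _.
under eq_bigr => H _ do rewrite mulr_suml.
rewrite exchange_big natr_sum !mulr_sumr /=; apply: eq_bigr => A _.
rewrite (bigD1 (attach G A)) //= eqxx big1 ?addr0; first by rewrite mulr1; ring.
by move=> H; rewrite eq_sym => /negbTE ->; rewrite mulr0 mul0r.
Qed.

Lemma sum_draws_cst n k : (\sum_(A : {set 'I_n} | #|A| == m) k)%N = ('C(n, m) * k)%N.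
Proof.
rewrite sum_nat_const; congr (_ * _)%N.
by rewrite -[n in RHS]card_ord -card_draws cardsE.
Qed.

(** Common pattern of the three recurrences below: [g] is what survives from the old graph, [h] what
    the draw [A] adds, and [H] bounds the total of [h] over all draws. *)
Lemma mean_succ_le n (f : sgraph n.+1 -> nat) (g H : sgraph n -> nat)
    (h : sgraph n -> {set 'I_n} -> nat) : (m < n)%N ->
  (forall G (A : {set 'I_n}), #|A| = m -> (f (attach G A) <= g G + h G A)%N) ->
  (forall G, (\sum_(A : {set 'I_n} | #|A| == m) h G A <= H G)%N) ->
  mean f <= mean g + 'C(n, m)%:R^-1 * mean H.
Proof.
move=> mn fgh hH; have C0 : 0 < 'C(n, m)%:R :> R by rewrite ltr0n bin_gt0 ltnW.
rewrite mean_succ // -(ler_pM2l C0) mulrDr !mulVKf ?gt_eqF //.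
apply: le_trans (_ : mean (fun G => 'C(n, m) * g G + H G)%N <= _).
  apply: mean_le => G; rewrite -sum_draws_cst.
  apply: leq_trans (leq_add (leqnn _) (hH G)); rewrite -big_split /=.
  by apply: leq_sum => A /eqP szA; apply: fgh.
rewrite /mean mulr_sumr -big_split /=; apply: ler_sum => G _.
by rewrite natrD natrM mulrDr mulrCA.
Qed.

Lemma mean_succ_ge n (f : sgraph n.+1 -> nat) (g : sgraph n -> nat) : (m < n)%N ->
  (forall G A, (g G <= f (attach G A))%N) -> mean g <= mean f.
Proof.
move=> mn fg; have C0 : 0 < 'C(n, m)%:R :> R by rewrite ltr0n bin_gt0 ltnW.
rewrite mean_succ // -(ler_pM2l C0) mulVKf ?gt_eqF //.
rewrite /mean mulr_sumr; apply: ler_sum => G _; rewrite mulrCA.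
rewrite ler_wpM2l ?ua_law_ge0 // -natrM ler_nat -sum_draws_cst.
by apply: leq_sum => A _; apply: fg.
Qed.

(** The process starts at a path power, since on m + 1 vertices it is complete; at each step a
    single term of the double sum is kept. *)
Lemma path_power_law_gt0 n : (m < n)%N -> 0 < ua_law R m n (path_power m n).
Proof.
elim: n => // n IHn; rewrite ltnS leq_eqVlt => /orP[/eqP <-|mn].
  by rewrite /= ltnn ffunE path_power_complete // eqxx ltr01.
rewrite /= mn ffunE; have [A szA eqA] := path_power_attach (ltnW mn).
have term_ge0 G (B : {set 'I_n}) (b : bool) :
    0 <= ua_law R m n G * 'C(n, m)%:R^-1 * b%:R.
  by rewrite !mulr_ge0 ?ua_law_ge0 ?invr_ge0.
rewrite (bigD1 (path_power m n)) //=; apply: ltr_wpDr.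
  by apply: sumr_ge0 => G _; apply: sumr_ge0 => B _; apply: term_ge0.
rewrite (bigD1 A) ?szA //=; apply: ltr_wpDr.
  by apply: sumr_ge0 => B _; apply: term_ge0.
by rewrite eqA eqxx mulr1 mulr_gt0 ?IHn // invr_gt0 ltr0n bin_gt0 ltnW.
Qed.

(** A new m-clique is the new vertex with m - 1 of its m neighbours, so each step adds at most m of
    them. *)
Lemma mean_cliques_succ n : (0 < m)%N -> (m < n)%N ->
  mean (fun G : sgraph n.+1 => #|cliques G m|) <=
  mean (fun G : sgraph n => #|cliques G m|) + m%:R.
Proof.
move=> m0 mn.
have C0 : 'C(n, m)%:R != 0 :> R by rewrite pnatr_eq0 -lt0n bin_gt0 ltnW.
apply: le_trans (_ : _ + 'C(n, m)%:R^-1 * mean (fun _ : sgraph n => 'C(n, m) * m)%N <= _);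
  last by rewrite mean_cst natrM mulKf.
apply: (@mean_succ_le _ _ _ _ (fun _ _ => m)) => // [G A szA|G]; last first.
  by rewrite sum_draws_cst.
rewrite -[in X in (#|cliques _ X| <= _)%N](prednK m0).
apply: leq_trans (card_cliques_attach _ _ _) _; rewrite (prednK m0) leq_add2l.
apply: leq_trans (card_cliques_within _ _ _) _.
by rewrite szA -[X in 'C(X, _)](prednK m0) binSn prednK.
Qed.

(** A step creates at most one (m+1)-clique, and only if the draw is itself an m-clique. *)
Lemma mean_big_cliques_succ n : (m < n)%N ->
  mean (fun G : sgraph n.+1 => #|cliques G m.+1|) <=
  mean (fun G : sgraph n => #|cliques G m.+1|) +
  'C(n, m)%:R^-1 * mean (fun G : sgraph n => #|cliques G m|).
Proof.
move=> mn; apply: (@mean_succ_le _ _ _ _ (fun G A => A \in cliques G m)) => // [G A szA|G].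
  apply: leq_trans (card_cliques_attach _ _ _) _; rewrite leq_add2l.
  exact: card_cliques_within_same.
rewrite -sum1_card big_mkcond [X in (_ <= X)%N]big_mkcond; apply: leq_sum => A _.
by case: ifP => //; case: ifP.
Qed.

Lemma mean_near_clique_succ n t : (m < n)%N ->
  mean (fun G : sgraph n.+1 => near_clique_from G m t) <=
  mean (fun G : sgraph n => near_clique_from G m t) +
  'C(n, m)%:R^-1 * (m.+1%:R * mean (fun G : sgraph n => #|cliques G m.+1|)).
Proof.
move=> mn.
rewrite (_ : _ * mean _ = mean (fun G : sgraph n => m.+1 * #|cliques G m.+1|)%N); last first.
  by rewrite /mean mulr_sumr; apply: eq_bigr => G _; rewrite natrM mulrCA.
apply: (@mean_succ_le _ _ _ _ (fun G A => extendable G m A)) => // [G A szA|G].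
  have := @near_clique_attach _ G m t A szA.
  case: (near_clique_from (attach G A) m t) => //= /(_ isT).
  by case: (near_clique_from G m t) => //= ->.
exact: card_extendable.
Qed.

End Mean.

(** * Real recurrence inequalities *)

Section Recurrence.
Variable R : realType.

(* The quantity [q n + C2 * (a n + C1) / n.-1] does not increase. *)
Lemma potential_bound (a q : nat -> R) (C1 C2 : R) t : 0 <= C2 -> (2 <= t)%N ->
  (forall n, (t <= n)%N -> a n.+1 <= a n + C1 / n.-1%:R) ->
  (forall n, (t <= n)%N -> q n.+1 <= q n + C2 * a n / (n * n.-1)%:R) ->
  (forall n, (t <= n)%N -> 0 <= a n + C1) ->
  forall n, (t <= n)%N -> q n <= q t + C2 * (a t + C1) / t.-1%:R.
Proof.
move=> C20 t2 ha hq hp.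
suff H n : (t <= n)%N -> q n + C2 * (a n + C1) / n.-1%:R <= q t + C2 * (a t + C1) / t.-1%:R.
  move=> n tn; apply: le_trans (H n tn); rewrite lerDl.
  by rewrite mulr_ge0 ?invr_ge0 // mulr_ge0 // hp.
elim: n => [|n IHn] tn; first by lia.
move: tn; rewrite leq_eqVlt => /orP[/eqP -> //|]; rewrite ltnS => tn.
apply: le_trans (IHn tn); have := hq n tn; have := ha n tn.
case: n tn {IHn} => [|[|k]]; [lia|lia|] => tn /=.
rewrite natrM; set x : R := k.+1%:R; set y : R := k.+2%:R => ha' hq'.
have x0 : 0 < x by rewrite ltr0n.
have y0 : 0 < y by rewrite ltr0n.
have yx : y = x + 1 by rewrite /y -natr1.
have h : C2 * (a k.+3 + C1) / y <= C2 * (a k.+2 + C1 / x + C1) / y.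
  by rewrite ler_pM2r ?invr_gt0 //; apply: ler_wpM2l => //; rewrite lerD2r.
apply: le_trans (lerD hq' h) _.
(* Both sides agree because 1/(xy) + 1/y = 1/x when y = x + 1, applied to [a] and to [C1] alike. *)
rewrite -addrA lerD2l le_eqVlt; apply/orP; left; apply/eqP.
rewrite yx; field; rewrite [1 + _]addrC natr1 -/x -yx; by rewrite !gt_eqF.
Qed.

(** The increments tend to 0, so from some index on the slope is at most e/2, and the value at that
    index is eventually absorbed by the other e/2. This suffices in place of the logarithmic
    bound. *)
Lemma sublinear (a : nat -> R) (C e : R) n0 : 0 < e -> (2 <= n0)%N -> 0 <= C ->
  (forall n, (n0 <= n)%N -> a n.+1 <= a n + C / n.-1%:R) ->
  exists2 t, (n0 <= t)%N & a t <= e * t%:R.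
Proof.
move=> e0 n02 C0 ha.
have e20 : 0 < e / 2 by rewrite divr_gt0.
pose N := (n0 + (Num.bound (C / (e / 2))).+1)%N.
have hN n : (N <= n)%N -> C / n.-1%:R <= e / 2.
  move=> Nn; have p0 : 0 < n.-1%:R :> R by rewrite ltr0n; rewrite /N in Nn; lia.
  rewrite ler_pdivrMr // mulrC -ler_pdivrMr //.
  have h : 0 <= C / (e / 2) by rewrite divr_ge0 // ltW.
  apply: le_trans (ltW (archi_boundP h)) _; rewrite ler_nat; rewrite /N in Nn; lia.
have lin k : a (N + k)%N <= a N + e / 2 * k%:R.
  elim: k => [|k IHk]; first by rewrite addn0 mulr0 addr0.
  rewrite addnS; apply: le_trans (ha _ _) _; first by rewrite /N; lia.
  apply: le_trans (lerD IHk (hN _ (leq_addr _ _))) _.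
  by rewrite -[k.+1%:R]natr1; lra.
(* Far enough for the initial value [a N] to be at most e/2 times [k]. *)
pose k := Num.bound (`|a N| / (e / 2)).
exists (N + k)%N; first by rewrite /N; lia.
apply: le_trans (lin k) _; rewrite natrD.
have hk : `|a N| <= e / 2 * k%:R.
  rewrite mulrC -ler_pdivrMr //; apply/ltW/archi_boundP.
  by rewrite divr_ge0 // ltW.
have h1 := ler_norm (a N).
have h2 : 0 <= e * N%:R by rewrite mulr_ge0 // ltW.
lra.
Qed.

End Recurrence.

(** * Bounding late near-cliques, and the conclusion *)

Lemma mean_near_clique_bounded (R : realType) m : (2 <= m)%N ->
  exists (t : nat) (d : R), d < 1 /\ forall n, (t <= n)%N ->
    mean R m (fun G : sgraph n => near_clique_from G m t) <= d.
Proof.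
move=> m2.
pose s n := mean R m (fun G : sgraph n => #|cliques G m|).
pose a n := mean R m (fun G : sgraph n => #|cliques G m.+1|).
pose q t n : R := mean R m (fun G : sgraph n => near_clique_from G m t).
have s0 n : 0 <= s n by apply: mean_ge0.
have a0 n : 0 <= a n by apply: mean_ge0.
(* The term [s m.+1] handles the base case of the linear bound on [s], the term [m] its inductive
   step. *)
pose c := m%:R + s m.+1.
have c0 : 0 <= c by rewrite addr_ge0.
have hs n : (m < n)%N -> s n <= c * n%:R.
  elim: n => // n IHn; rewrite ltnS leq_eqVlt => /orP[/eqP <-|mn].
    rewrite -natr1 mulrDr mulr1; apply: le_trans (_ : c <= _).
      by rewrite /c lerDr.
    by rewrite lerDr mulr_ge0.
  apply: le_trans (mean_cliques_succ R (ltnW m2) mn) _.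
  rewrite -natr1 mulrDr mulr1 lerD ?IHn //; first by rewrite /c lerDl.
have hC n : (m < n)%N -> ('C(n, m)%:R)^-1 <= (m ^ 2)%:R / (n * n.-1)%:R :> R.
  move=> mn; have C0 : 0 < 'C(n, m)%:R :> R by rewrite ltr0n bin_gt0 ltnW.
  rewrite ler_pdivlMr; last by rewrite ltr0n; case: n mn {C0} => [|[|n]] //; lia.
  by rewrite mulrC ler_pdivrMr // -natrM ler_nat binomial_ge_square.
pose C1 := (m ^ 2)%:R * c.
pose C2 : R := (m ^ 2)%:R * m.+1%:R.
have C10 : 0 <= C1 by rewrite mulr_ge0.
have C20 : 0 < C2 by rewrite /C2 -natrM ltr0n; lia.
have ha n : (m < n)%N -> a n.+1 <= a n + C1 / n.-1%:R.
  move=> mn; apply: le_trans (mean_big_cliques_succ R mn) _; rewrite lerD2l.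
  apply: le_trans (ler_pM _ _ (hC _ mn) (hs _ mn)) _; rewrite ?invr_ge0 //.
  rewrite natrM /C1 le_eqVlt; apply/orP; left; apply/eqP; field.
  by rewrite !pnatr_eq0; apply/andP; split; lia.
have hq t n : (m < n)%N -> q t n.+1 <= q t n + C2 * a n / (n * n.-1)%:R.
  move=> mn; apply: le_trans (mean_near_clique_succ R t mn) _; rewrite lerD2l.
  rewrite -[mean _ _ _]/(a n).
  apply: le_trans (ler_wpM2r _ (hC _ mn)) _; first by rewrite mulr_ge0.
  by rewrite /C2 le_eqVlt; apply/orP; left; apply/eqP; ring.
have C24 : 0 < 4 * C2 by apply: mulr_gt0.
have e0 : 0 < (4 * C2)^-1 by rewrite invr_gt0.
(* Any t >= n0 satisfies m < t, 2 <= t - 1 and 4 C2 C1 <= t - 1. *)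
pose n0 := (m.+1 + (Num.bound (4 * C2 * C1)).+2)%N.
have [t n0t hat] : exists2 t, (n0 <= t)%N & a t <= (4 * C2)^-1 * t%:R.
  apply: (@sublinear _ _ C1) => //; first by rewrite /n0; lia.
  by move=> n n0n; apply: ha; rewrite /n0 in n0n; lia.
have mt : (m < t)%N by rewrite /n0 in n0t; lia.
exists t, (C2 * (a t + C1) / t.-1%:R); split; last first.
  (* On t vertices the labels stop at t - 1, so the recurrence for [q t] starts from 0. *)
  move=> n tn; have qt : q t t = 0.
    apply: mean0 => G; apply/eqP; rewrite eqb0; apply/negP.
    move=> /near_clique_fromP[K [u [w [v [_ _ _ _ [tv _]]]]]].
    by move: (ltn_ord v); rewrite ltnNge tv.
  rewrite -[leRHS]add0r -qt; apply: (potential_bound (ltW C20)) => //.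
  - by lia.
  - by move=> k tk; apply: ha; lia.
  - by move=> k tk; apply: hq; lia.
  - by move=> k _; rewrite addr_ge0.
(* With x = t - 1, C2 a(t) is at most (x + 1)/4 and C2 C1 at most x/4; their sum is below x since x
   >= 2. *)
have hC1 : 4 * C2 * C1 <= t.-1%:R.
  apply: le_trans (ltW (archi_boundP _)) _; first by rewrite !mulr_ge0 // ltW.
  by rewrite ler_nat; rewrite /n0 in n0t; lia.
have t1 : 2 <= t.-1%:R :> R by rewrite ler_nat; rewrite /n0 in n0t; lia.
have tE : t%:R = t.-1%:R + 1 :> R by rewrite natr1 prednK //; lia.
rewrite ltr_pdivrMr; last by lra.
move: hat; rewrite mulrC ler_pdivlMr // tE => hat.
lra.
Qed.

Local Open Scope classical_set_scope.
Local Open Scope ring_scope.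

Theorem mainTheorem3 (R : realType) (m : nat) (hm : (2 <= m)%N) :
  ~ obeys_FO_01_law (ua_law R m) /\
  exists phi : fo_sentence,
    ~ (prob_models (ua_law R m) phi n @[n --> \oo] --> (0 : R)) /\
    ~ (prob_models (ua_law R m) phi n @[n --> \oo] --> (1 : R)).
Proof.
suff H : exists phi : fo_sentence,
    ~ (prob_models (ua_law R m) phi n @[n --> \oo] --> (0 : R)) /\
    ~ (prob_models (ua_law R m) phi n @[n --> \oo] --> (1 : R)).
  by split=> // law; have [phi [h0 h1]] := H; case: (law phi).
have [t [d [d1 hd]]] := mean_near_clique_bounded R hm.
(* The sentence speaks of a path on M + 1 vertices, which exceeds both t and m + 1, as the
   near-clique argument requires. *)
pose M := (t + m.+1)%N; pose phi := path_power_sentence m M.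
exists phi; split=> lim.
  pose p := prob_models (ua_law R m) phi M.+1.
  have p0 : 0 < p.
    apply: lt_le_trans (path_power_law_gt0 R (_ : m < M.+1)%N) _; first by rewrite /M; lia.
    rewrite /p /prob_models /prob_of (bigD1 (path_power m M.+1)) /=; last first.
      by apply/models_path_power/path_power_has_path_power.
    by rewrite lerDl; apply: sumr_ge0 => G _; apply: ua_law_ge0.
  (* Having a copy of the path power survives attachment, so its probability never drops below the
     positive value [p]. *)
  have up n : (M < n)%N -> p <= prob_models (ua_law R m) phi n.
    elim: n => // n IHn; rewrite ltnS leq_eqVlt => /orP[/eqP <- //|Mn].
    apply: le_trans (IHn Mn) _; rewrite /prob_models !prob_of_mean.
    apply: mean_succ_ge; first by rewrite /M in Mn; lia.
    move=> G A; case: (boolP (models G phi)) => // /models_path_power hG.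
    rewrite (_ : models (attach G A) phi = true) //.
    by apply/models_path_power/has_path_power_attach.
  have [N _ hN] := cvgr_lt _ lim _ p0.
  have := hN (maxn N M.+1) (leq_maxl _ _) => /=.
  by rewrite ltNge up // leq_maxr.
(* From t on, the probability is at most that of a late near-clique, hence at most d < 1. *)
have [N _ hN] := cvgr_gt _ lim _ d1.
have := hN (maxn N t) (leq_maxl _ _) => /=; rewrite ltNge => /negP; apply.
apply: le_trans (hd _ (leq_maxr _ _)); rewrite /prob_models prob_of_mean.
apply: mean_le => G; case: (boolP (models G phi)) => // /models_path_power hG.
by rewrite (path_power_near_clique _ _ hG) // /M; lia.
Qed.
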